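(* Let $d\ge 2$ be an integer. Every digraph $D$ with $m$ arcs whose minimum outdegree and minimum indegree are both at least $d$ admits a bipartition $V(D)=V_1\cup V_2$ with $$\min\{e(V_1,V_2),\,e(V_2,V_1)\}\ \ge\ \Big(\frac{d-1}{2(2d-1)}+o(1)\Big)m,$$ where $o(1)$ denotes a (possibly negative) quantity tending to $0$ as $m\to\infty$ with $d$ fixed. Explicitly: for every integer $d\ge 2$ and every real $\varepsilon>0$ there exists $m_0=m_0(d,\varepsilon)$ such that every digraph $D$ with $m\ge m_0$ arcs, in which every vertex has outdegree at least $d$ and indegree at least $d$, admits a partition $V(D)=V_1\cup V_2$ with $\min\{e(V_1,V_2),e(V_2,V_1)\}\ge \big(\frac{d-1}{2(2d-1)}-\varepsilon\big)m$.
   Context: All digraphs (directed graphs) are finite, with no loops and no parallel arcs (i.e. for each ordered pair $(x,y)$ of distinct vertices there is at most one arc from $x$ to $y$; both arcs $xy$ and $yx$ may be present simultaneously). $V(D)$ is the vertex set and $A(D)$ the arc set of $D$; $xy$ denotes the arc directed from $x$ to $y$. The outdegree of a vertex $x$ is $d^+(x)=|\{z: xz\in A(D)\}|$ and its indegree is $d^-(x)=|\{z: zx\in A(D)\}|$; the minimum outdegree (indegree) of $D$ is the minimum of $d^+(x)$ (respectively $d^-(x)$) over all $x\in V(D)$. For $S,T\subseteq V(D)$, $e(S,T)$ denotes the number of arcs of $D$ directed from $S$ to $T$. A bipartition $V(D)=V_1\cup V_2$ means that $V_1$ and $V_2$ are disjoint with union $V(D)$. *)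

(* Defs.v *)
From mathcomp Require Import all_boot all_order all_algebra.

Set Implicit Arguments.
Unset Strict Implicit.
Unset Printing Implicit Defensive.

(* A digraph on V is given by its arc relation D, [D x y] meaning that xy is an
   arc; a relation has no parallel arcs, and looplessness is [irreflexive D]. *)
Section Digraph.
Variables (V : finType) (D : rel V).

Definition arcs : {set V * V} := [set p | D p.1 p.2].

Definition outdeg (x : V) : nat := #|[set z | D x z]|.

Definition indeg (x : V) : nat := #|[set z | D z x]|.

Definition arcs_between (S T : {set V}) : nat :=
  #|[set p in arcs | (p.1 \in S) && (p.2 \in T)]|.

End Digraph.

(* The parts may be empty. *)
Definition bipartition (V : finType) (V1 V2 : {set V}) : Prop :=
  V1 :|: V2 = [set: V] /\ [disjoint V1 & V2].

(* Main.v *)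
Require Import Defs.
From mathcomp Require Import all_boot all_order all_algebra.
From mathcomp Require Import reals.
From mathcomp Require Import zify ring lra.

(** Let [chi] assign a sign to every vertex, and let [V1] be the set of vertices of
sign [+1].  The numbers of arcs from [V1] to [V2] and back add up to the size of the
cut and differ by half of the signed sum of the net degrees (outdegree minus
indegree), which is linear in [chi].  So it suffices to find signs with a large cut
and a small signed sum.

Call the vertices of degree more than [delta], a small multiple of the number [m] of
arcs, hubs: by double counting their number is bounded in terms of [eps] alone, so
arcs between hubs do not matter.  Let [n0] be the number of non-hubs having a hub neighbour.  The
net degree of a hub is at most [n0] plus the number of hubs, hence a greedy choice of
the signs of the hubs keeps their signed sum below the same bound
([balanced_signs], [net_hub]).

Among the non-hubs, take vertex-disjoint pieces, each an edge or an induced path on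
three vertices, that together cover as many vertices as possible.  Give the two sides
of each piece opposite signs, and flip every piece and every uncovered vertex by an
independent random sign.  Each of the [q] arcs inside the pieces is cut, and each
other arc with an end outside the hubs is cut with probability one half.  The variance
of the signed sum of the non-hubs is at most a constant times [delta * m], as blocks
have at most three vertices.  Hence twice the smaller of the two arc counts can be
made at least [m / 2 + q / 2 - n0 / 2] minus a small multiple of [m]
([blockwise_bipartition], [bipartition_few_hubs]).

What remains is the inequality [(2 * d - 1) * n0 <= (2 * d - 1) * q + m], proved in
[charging].  It uses that every degree (outdegree plus indegree) is at least [2 * d],
and what maximality says about uncovered vertices: no two of them are adjacent, an
edge of the packing is adjacent to at most one of them, and a path of the packing is
adjacent to them only through its middle vertex ([uncovered_independent],
[edge_nbr_both], [edge_nbr_unique], [cherry_nbr]). *)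

Set Implicit Arguments.
Unset Strict Implicit.
Unset Printing Implicit Defensive.

(** * Packings by edges and induced paths on three vertices *)

Section StarPacking.
Variables (V : finType) (g : rel V) (B : {set V}).
Hypotheses (gsym : symmetric g) (girr : irreflexive g).
Implicit Types (P Q N : {set {set V}}) (T : {set V}).

(** Stars are induced, so that signing the centre against the leaves cuts every arc
inside. *)
Definition star (x : V) (T : {set V}) :=
  [&& x \in T, [forall y in T :\ x, g x y]
    & [forall y in T :\ x, forall z in T :\ x, ~~ g y z]].

(** With two vertices a piece is an edge, with three an induced path.  Small pieces
keep the variance of a random signing small, and two leaves suffice for the
counting in [charging]. *)
Definition piece (T : {set V}) :=
  [&& T \subset B, 2 <= #|T| <= 3 & [exists x, star x T]].

Definition packing (P : {set {set V}}) := trivIset P && [forall T in P, piece T].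

Definition max_packing (P : {set {set V}}) :=
  packing P /\ forall Q, packing Q -> #|cover Q| <= #|cover P|.

Lemma exists_max_packing : exists P, max_packing P.
Proof.
have p0 : packing set0.
  apply/andP; split; last by apply/forall_inP=> T; rewrite inE.
  by apply/trivIsetP=> T; rewrite inE.
by case: (arg_maxnP (fun P => #|cover P|) p0) => P pP mP; exists P.
Qed.

Lemma packingP P T : packing P -> T \in P -> piece T.
Proof. by case/andP=> _ /forall_inP; apply. Qed.

Lemma packingS P Q : Q \subset P -> packing P -> packing Q.
Proof.
move=> QP /andP[tP /forall_inP sP]; apply/andP; split; first exact: trivIsetS tP.
by apply/forall_inP=> T /(subsetP QP)/sP.
Qed.

Lemma packingU P Q : packing P -> packing Q -> [disjoint cover P & cover Q] ->
  packing (P :|: Q).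
Proof.
move=> /andP[tP /forall_inP sP] /andP[tQ /forall_inP sQ] dPQ.
apply/andP; split; first exact: trivIsetU.
by apply/forall_inP=> T /setUP[/sP|/sQ].
Qed.

Lemma packing1 T : piece T -> packing [set T].
Proof.
move=> pT; apply/andP; split; first exact: trivIset1.
by apply/forall_inP=> S /set1P->.
Qed.

Lemma cover_subset P : packing P -> cover P \subset B.
Proof.
by move=> pP; apply/bigcupsP=> T /(packingP pP)/and3P[].
Qed.

Lemma coverU P Q : cover (P :|: Q) = cover P :|: cover Q.
Proof. by rewrite /cover bigcup_setU. Qed.

(** Every local improvement used below keeps a subfamily [Q] of a maximum packing
and adds a new family [N]. *)
Lemma exchange P Q N : max_packing P -> Q \subset P -> packing N ->
  [disjoint cover Q & cover N] -> #|cover Q| + #|cover N| <= #|cover P|.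
Proof.
move=> [pP mP] QP pN dQN; rewrite -cardsUI (disjoint_setI0 dQN) cards0 addn0.
by rewrite -coverU mP // packingU // (packingS QP).
Qed.

Lemma card_cover_rem P T : packing P -> T \in P ->
  #|cover (P :\ T)| + #|T| = #|cover P|.
Proof.
move=> /andP[tP _] PT; rewrite coverD1 // cardsD (setIidPr _) ?subnK //.
  exact/subset_leq_card/bigcup_sup.
exact: bigcup_sup.
Qed.

Lemma exchange1 P T N : max_packing P -> T \in P -> packing N ->
  [disjoint cover N & cover P :\: T] -> #|cover N| <= #|T|.
Proof.
move=> mP PT pN dN; have [pP _] := mP.
rewrite -(leq_add2l #|cover (P :\ T)|) (card_cover_rem pP PT).
apply: exchange (mP) _ pN _; first exact: subsetDl.
by rewrite coverD1 1?disjoint_sym //; case/andP: pP.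
Qed.

Lemma piece_edge x y : x \in B -> y \in B -> g x y -> piece [set x; y].
Proof.
move=> xB yB gxy; have xy : x != y by apply: contraTneq gxy => ->; rewrite girr.
apply/and3P; split; first by rewrite subUset !sub1set xB.
  by rewrite cards2 xy.
apply/existsP; exists x; apply/and3P; split; first by rewrite !inE eqxx.
  by apply/forall_inP=> z; rewrite !inE => /andP[/negPf->] /= /eqP->.
apply/forall_inP=> z; rewrite !inE => /andP[/negPf->] /= /eqP->.
by apply/forall_inP=> t; rewrite !inE => /andP[/negPf->] /= /eqP->; rewrite girr.
Qed.

Lemma piece_cherry x y z : x \in B -> y \in B -> z \in B ->
  g x y -> g x z -> ~~ g y z -> y != z -> piece [set x; y; z].
Proof.
move=> xB yB zB gxy gxz gyz yz.
have xy : x != y by apply: contraTneq gxy => ->; rewrite girr.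
have xz : x != z by apply: contraTneq gxz => ->; rewrite girr.
apply/and3P; split; first by rewrite !subUset !sub1set xB yB.
  by rewrite setUC cardsU1 !inE cards2 negb_or eq_sym xz eq_sym yz xy.
apply/existsP; exists x; apply/and3P; split; first by rewrite !inE eqxx.
  by apply/forall_inP=> t; rewrite !inE => /andP[/negPf->] /= /orP[] /eqP->.
apply/forall_inP=> t; rewrite !inE => /andP[/negPf->] /= /orP[] /eqP->;
apply/forall_inP=> s; rewrite !inE => /andP[/negPf->] /= /orP[] /eqP->;
by rewrite ?girr // gsym.
Qed.

Lemma packing2 T S : piece T -> piece S -> [disjoint T & S] ->
  packing [set T; S].
Proof.
by move=> pT pS dTS; apply: packingU; rewrite ?packing1 // !cover1.
Qed.

Section Maximal.
Variable P : {set {set V}}.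
Hypothesis mP : max_packing P.
Let U := B :\: cover P.

Let pP : packing P. Proof. by case: mP. Qed.

(** Two adjacent uncovered vertices would form one more piece. *)
Lemma uncovered_independent u v : u \in U -> v \in U -> ~~ g u v.
Proof.
case/setDP=> uB uP /setDP[vB vP]; apply/negP=> guv.
have uv : u != v by apply: contraTneq guv => ->; rewrite girr.
have := exchange mP (subxx P) (packing1 (piece_edge uB vB guv)).
rewrite cover1 cards2 uv addn2 ltnNge leqnSn => H.
suff: false by [].
by apply: H; rewrite disjoint_sym disjoints_subset subUset !sub1set !inE uP.
Qed.

Lemma card_improvement T N : T \in P -> packing N -> cover N \subset T :|: U ->
  #|cover N| <= #|T|.
Proof.
move=> PT pN sN; apply: exchange1 (mP) PT pN _.
rewrite disjoints_subset; apply: subset_trans sN _.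
by apply/subsetP=> x; rewrite !inE => /orP[->|/andP[/negPf->]] //; rewrite andbF.
Qed.

Lemma edge_shape x y : piece [set x; y] -> x != y -> g x y.
Proof.
move=> /and3P[_ _ /existsP[c /and3P[cT /forall_inP gc _]]] xy.
move: cT gc; rewrite !inE => /orP[/eqP->|/eqP->] gc.
  by apply: gc; rewrite !inE eqxx orbT andbT eq_sym.
by rewrite gsym; apply: gc; rewrite !inE eqxx xy.
Qed.

Let memT T x : T \in P -> x \in T -> x \in B.
Proof. by move=> PT; apply: subsetP; case/and3P: (packingP pP PT). Qed.

Let notT T u : T \in P -> u \in U -> u \notin T.
Proof.
move=> PT /setDP[_]; apply: contra => uT.
by apply/bigcupP; exists T.
Qed.

(** If [u] saw only [x], the three vertices would form an induced path, a larger
piece. *)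
Lemma edge_nbr_both x y u : x != y -> [set x; y] \in P -> u \in U ->
  g u x -> g u y.
Proof.
move=> xy PT uU gux; apply/negPn/negP=> nuy.
have gxy := edge_shape (packingP pP PT) xy.
have xT : x \in [set x; y] by rewrite !inE eqxx.
have yT : y \in [set x; y] by rewrite !inE eqxx orbT.
have uT := notT PT uU; have [uB _] := setDP uU.
have uy : u != y by apply: contraNneq uT => ->.
have := card_improvement PT (packing1 (@piece_cherry x y u (memT PT xT) (memT PT yT) uB
   gxy _ _ _)).
rewrite cover1 gsym gux gsym nuy eq_sym uy => /(_ isT isT isT).
rewrite subUset subsetUl sub1set inE uU orbT => /(_ isT).
by rewrite setUC cardsU1 uT add1n ltnn.
Qed.

(** Two different uncovered neighbours would turn the path [u x y v] into two
disjoint edges.  With [edge_nbr_both], an edge of the packing has at most one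
uncovered neighbour. *)
Lemma edge_nbr_unique x y u v : x != y -> [set x; y] \in P ->
  u \in U -> v \in U -> g u x -> g v y -> u = v.
Proof.
move=> xy PT uU vU gux gvy; apply/eqP/negPn/negP=> uv.
have xT : x \in [set x; y] by rewrite !inE eqxx.
have yT : y \in [set x; y] by rewrite !inE eqxx orbT.
have [uB _] := setDP uU; have [vB _] := setDP vU.
have ux := notT PT uU; have vx := notT PT vU.
have d : [disjoint [set u; x] & [set v; y]].
  rewrite disjoints_subset subUset !sub1set !inE negb_or uv negb_or xy.
  by move: ux vx; rewrite !inE !negb_or => /andP[_ ->] /andP[+ _]; rewrite eq_sym => ->.
have := card_improvement PT (packing2 (piece_edge uB (memT PT xT) gux)
   (piece_edge vB (memT PT yT) gvy) d).
rewrite coverU !cover1 !subUset !sub1set !inE !eqxx !orbT.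
move: (uU) (vU); rewrite !inE => -> ->; rewrite !orbT => /(_ isT).
rewrite cardsU (disjoint_setI0 d) cards0 !cards2 xy.
move: ux vx; rewrite !inE !negb_or => /andP[-> _] /andP[_ ->].
by [].
Qed.

(** An uncovered neighbour of a leaf could be paired with that leaf, leaving the
other leaf paired with the centre. *)
Lemma cherry_nbr x T u y : T \in P -> #|T| = 3 -> star x T -> u \in U ->
  y \in T -> y != x -> ~~ g u y.
Proof.
move=> PT T3 /and3P[xT /forall_inP gx _] uU yT yx; apply/negP=> guy.
have yD : y \in T :\ x by rewrite !inE yx.
have : #|T :\ x :\ y| = 1.
  by have := cardsD1 x T; have := cardsD1 y (T :\ x); rewrite xT yD T3; lia.
case/eqP/cards1P=> z Ez.
have : z \in T :\ x :\ y by rewrite Ez inE.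
case/setD1P=> zy zD; have /setD1P[zx zT] := zD.
have [uB _] := setDP uU; have uT := notT PT uU.
have nu t : t \in T -> u != t by move=> tT; apply: contraNneq uT => ->.
have d : [disjoint [set u; y] & [set x; z]].
  by rewrite disjoints_subset subUset !sub1set !inE !negb_or yx !nu //= eq_sym.
have := card_improvement PT (packing2 (piece_edge uB (memT PT yT) guy)
   (piece_edge (memT PT xT) (memT PT zT) (gx z zD)) d).
rewrite coverU !cover1 !subUset !sub1set !inE xT yT zT.
move: (uU); rewrite !inE => ->; rewrite !orbT => /(_ isT).
by rewrite cardsU (disjoint_setI0 d) cards0 !cards2 (nu y) // eq_sym zx T3.
Qed.

End Maximal.
End StarPacking.

(** * Charging vertices near hubs to arcs *)

Section Charging.
Variables (V : finType) (D : rel V).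
Hypothesis Dirr : irreflexive D.

(** Opposite arcs are counted separately, so a pair has multiplicity up to two. *)
Definition mult (x y : V) : nat := D x y + D y x.
Definition adj (x y : V) := D x y || D y x.

Lemma adj_sym : symmetric adj.
Proof. by move=> x y; rewrite /adj orbC. Qed.

Lemma adj_irr : irreflexive adj.
Proof. by move=> x; rewrite /adj Dirr. Qed.

Lemma multC x y : mult x y = mult y x.
Proof. by rewrite /mult addnC. Qed.

Lemma mult_gt0 x y : (0 < mult x y) = adj x y.
Proof. by rewrite /mult /adj; case: (D x y); case: (D y x). Qed.

Lemma mult_eq0 x y : ~~ adj x y -> mult x y = 0.
Proof. by rewrite -mult_gt0 lt0n negbK => /eqP. Qed.

Lemma mult_le2 x y : mult x y <= 2.
Proof. by rewrite /mult; case: (D x y); case: (D y x). Qed.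

Lemma card_arcs : #|arcs D| = \sum_x \sum_y D x y.
Proof.
rewrite pair_big /= -sum1_card big_mkcond.
by apply: eq_bigr => -[x y] _; rewrite inE /=; case: (D x y).
Qed.

Lemma outdeg_sum x : outdeg D x = \sum_y D x y.
Proof.
by rewrite /outdeg -sum1_card big_mkcond; apply: eq_bigr => y _; rewrite inE; case: (D x y).
Qed.

Lemma indeg_sum x : indeg D x = \sum_y D y x.
Proof.
by rewrite /indeg -sum1_card big_mkcond; apply: eq_bigr => y _; rewrite inE; case: (D y x).
Qed.

Lemma degree_sum x : outdeg D x + indeg D x = \sum_y mult x y.
Proof. by rewrite outdeg_sum indeg_sum -big_split. Qed.

Lemma handshake : \sum_x (outdeg D x + indeg D x) = 2 * #|arcs D|.
Proof.
rewrite big_split /= card_arcs mul2n -addnn.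
congr (_ + _); first by apply: eq_bigr => x _; exact: outdeg_sum.
by rewrite exchange_big; apply: eq_bigr => x _; exact: indeg_sum.
Qed.

Definition arcs_in (T : {set V}) := \sum_(x in T) \sum_(y in T) D x y.

Variable A : {set V}.
Let B := ~: A.

(** The set [A] plays the part of the hubs: the degree of a vertex [b] outside [A]
is split into what goes to [A] and what stays outside. *)
Definition hub_mult b := \sum_(a in A) mult b a.
Definition low_mult b := \sum_(y in B) mult b y.

Lemma degree_split b : outdeg D b + indeg D b = hub_mult b + low_mult b.
Proof.
rewrite degree_sum (bigID (mem A)) /=; congr (_ + _).
by apply: eq_bigl => y; rewrite inE.
Qed.

(** Arcs with both ends outside [A] are seen from two ends, arcs with one end
outside [A] from one end, whence the weight two on [hub_mult]. *)
Lemma low_arcs_bound :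
  \sum_(b in B) (2 * hub_mult b + low_mult b) <= 2 * #|arcs D|.
Proof.
rewrite -handshake [leqRHS](bigID (mem A)) /=.
have -> : \sum_(b in B) (2 * hub_mult b + low_mult b)
  = \sum_(b in B) hub_mult b + \sum_(b in B) (outdeg D b + indeg D b).
  by rewrite -big_split; apply: eq_bigr => b _ /=; rewrite degree_split; lia.
apply: leq_add; last first.
  by rewrite leq_eqVlt; apply/orP; left; apply/eqP; apply: eq_bigl => b; rewrite inE.
rewrite exchange_big; apply: leq_sum => a _ /=.
rewrite degree_split (eq_bigr (mult a)) ?leq_addl // => b _; exact: multC.
Qed.

Variable d : nat.
Hypothesis d_gt0 : 0 < d.
Hypothesis deg2d : forall b, b \in B -> 2 * d <= hub_mult b + low_mult b.
Let c := 2 * d - 1.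

Let cE : 2 * c + 2 = 4 * d. Proof. by rewrite /c; lia. Qed.

(** With a hub neighbour, [2 * hub_mult b + low_mult b] is at least the degree plus
one, hence at least [2 * d + 1], which is [2 * d - 3] short of [2 * c]; without hub
neighbours nothing has to be paid. *)
Lemma vertex_deficit b : b \in B ->
  2 * c * (0 < hub_mult b) + 3 <= 2 * hub_mult b + low_mult b + 2 * d.
Proof.
by move/deg2d; rewrite /c; case: (hub_mult b) => [|h] /=; nia.
Qed.

Variable P : {set {set V}}.
Hypothesis mP : max_packing adj B P.
Let U := B :\: cover P.

Let pP : packing adj B P. Proof. by case: mP. Qed.

(** Beyond paying for its own two vertices, an edge has [4] left, and this covers
all its arcs to uncovered vertices: they all go to the same vertex. *)
Lemma edge_charge T : T \in P -> #|T| = 2 ->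
  2 * c * \sum_(v in T) (0 < hub_mult v) + \sum_(u in U) \sum_(v in T) mult u v
    <= 2 * c * arcs_in T + \sum_(v in T) (2 * hub_mult v + low_mult v).
Proof.
move=> PT T2; have /and3P[TB _ _] := packingP pP PT.
have /eqP/cards2P[x [y [xy defT]]] := T2.
have xT : x \in T by rewrite defT !inE eqxx.
have yT : y \in T by rewrite defT !inE eqxx orbT.
have gxy : adj x y by apply: (edge_shape adj_sym) xy; rewrite -defT; apply: packingP pP PT.
have sumT (F : V -> nat) : \sum_(v in T) F v = F x + F y.
  by rewrite defT big_setU1 ?inE //= big_set1.
have eT : 1 <= arcs_in T.
  rewrite /arcs_in !sumT; have : 0 < D x y + D y x by rewrite mult_gt0.
  by clear; lia.
have private : \sum_(u in U) \sum_(v in T) mult u v <= 4.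
  have [u /andP[uU ux]|none] := pickP [pred u | (u \in U) && (adj u x || adj u y)];
    last first.
    rewrite big1 // => u uU; have := none u; rewrite /= uU /= => /norP[nx ny].
    by rewrite sumT !mult_eq0.
  have both w : w \in U -> adj w x || adj w y -> adj w x && adj w y.
    move=> wU /orP[wx|wy]; apply/andP; split=> //.
      by apply: (edge_nbr_both adj_sym adj_irr mP xy) wx; rewrite -?defT.
    apply: (edge_nbr_both adj_sym adj_irr mP (x := y)) wy => //.
      by rewrite eq_sym.
    by rewrite setUC -defT.
  rewrite (bigD1 u) //= [X in _ + X]big1 => [|v /andP[vU vu]].
    by rewrite sumT addn0 (leq_add (mult_le2 _ _) (mult_le2 _ _)).
  have [adjv|/norP[nx ny]] := boolP (adj v x || adj v y).
    have /andP[ux' _] := both u uU ux; have /andP[_ vy] := both v vU adjv.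
    have uv : u = v.
      by apply: (edge_nbr_unique adj_irr mP xy _ uU vU ux' vy); rewrite -defT.
    by rewrite uv eqxx in vu.
  by rewrite sumT !mult_eq0.
have := vertex_deficit (subsetP TB x xT); have := vertex_deficit (subsetP TB y yT).
have : 2 * c <= 2 * c * arcs_in T by rewrite leq_pmulr.
by rewrite !sumT mulnDr; move: (2 * c) cE private => k; clear; lia.
Qed.

(** Only the centre [x] has uncovered neighbours.  It gives up its whole
[low_mult] for them, and the two arcs to the leaves make up for that. *)
Lemma cherry_charge T : T \in P -> #|T| = 3 ->
  2 * c * \sum_(v in T) (0 < hub_mult v) + \sum_(u in U) \sum_(v in T) mult u v
    <= 2 * c * arcs_in T + \sum_(v in T) (2 * hub_mult v + low_mult v).
Proof.
move=> PT T3; have /and3P[TB _ /existsP[x sx]] := packingP pP PT.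
have /and3P[xT /forall_inP gx _] := sx.
have T2 : #|T :\ x| == 2 by have := cardsD1 x T; rewrite xT T3; lia.
have /cards2P[y [z [yz defT]]] := T2.
have yD : y \in T :\ x by rewrite defT !inE eqxx.
have zD : z \in T :\ x by rewrite defT !inE eqxx orbT.
have [/setD1P[yx yT] /setD1P[zx zT]] := (yD, zD).
have sumT (F : V -> nat) : \sum_(v in T) F v = F x + (F y + F z).
  rewrite (bigD1 x) //=; congr (_ + _).
  transitivity (\sum_(v in [set y; z]) F v).
    by apply: eq_bigl => v; rewrite -defT !inE andbC.
  by rewrite big_setU1 ?inE //= big_set1.
have eT : 2 <= arcs_in T.
  have two (a11 a12 a13 a21 a22 a23 a31 a32 a33 : nat) :
      0 < a12 + a21 -> 0 < a13 + a31 ->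
    2 <= a11 + (a12 + a13) + ((a21 + (a22 + a23)) + (a31 + (a32 + a33))).
    by clear; lia.
  by rewrite /arcs_in !sumT two // -/(mult _ _) mult_gt0 gx.
have private : \sum_(u in U) \sum_(v in T) mult u v <= low_mult x.
  rewrite /low_mult [leqRHS](bigID (mem (cover P))) /=.
  apply: leq_trans (leq_addl _ _).
  rewrite (eq_bigr (mult x)) => [|u uU].
    by rewrite leq_eqVlt; apply/orP; left; apply/eqP; apply: eq_bigl => v; rewrite !inE andbC.
  have leaf0 t : t \in T -> t != x -> mult u t = 0.
    by move=> tT tx; apply: mult_eq0; apply: (cherry_nbr adj_irr mP PT T3 sx).
  by rewrite sumT (leaf0 y) // (leaf0 z) // !addn0 (multC u x).
have := vertex_deficit (subsetP TB y yT); have := vertex_deficit (subsetP TB z zT).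
have : 2 * c * 2 <= 2 * c * arcs_in T by rewrite leq_mul2l eT orbT.
have : 2 * c * (0 < hub_mult x) <= 2 * hub_mult x + 2 * c.
  apply: leq_trans (leq_addl _ _).
  by rewrite -[leqRHS]muln1 leq_mul2l leq_b1 orbT.
rewrite !sumT !mulnDr; move: private; move: (\sum_(u in U) _) => X.
move: (2 * c * arcs_in T) (2 * c * (0 < hub_mult x)) (2 * c * (0 < hub_mult y))
  (2 * c * (0 < hub_mult z)) => e kx ky kz.
by move: (2 * c) cE => k; clear; lia.
Qed.

(** Each piece passes the multiplicity of its arcs to uncovered vertices on to
those vertices.  As no arc joins two uncovered vertices, an uncovered [u] receives
[low_mult u] in all; so it holds [2 * hub_mult u + 2 * low_mult u >= 4 * d], which
exceeds [2 * c]. *)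
Lemma charging :
  2 * c * \sum_(b in B) (0 < hub_mult b)
    <= 2 * c * (\sum_(T in P) arcs_in T) + 2 * #|arcs D|.
Proof.
apply: leq_trans (leq_add (leqnn _) low_arcs_bound).
have tP : trivIset P by case/andP: pP.
have PB : cover P \subset B := cover_subset pP.
have splitB (F : V -> nat) :
    \sum_(b in B) F b = \sum_(T in P) \sum_(v in T) F v + \sum_(u in U) F u.
  rewrite (bigID (mem (cover P))) /= -big_trivIset //; congr (_ + _).
    by apply: eq_bigl => v; rewrite andbC; case: (boolP (v \in cover P)) => // /(subsetP PB) ->.
  by apply: eq_bigl => v; rewrite !inE andbC.
have perT T : T \in P ->
  2 * c * \sum_(v in T) (0 < hub_mult v) + \sum_(u in U) \sum_(v in T) mult u v
    <= 2 * c * arcs_in T + \sum_(v in T) (2 * hub_mult v + low_mult v).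
  move=> PT; have /and3P[_ T23 _] := packingP pP PT.
  have [T2|T2] := eqVneq #|T| 2; first exact: edge_charge.
  by apply: cherry_charge => //; move: T23 T2; lia.
have perU u : u \in U -> 2 * c * (0 < hub_mult u) <=
    2 * hub_mult u + low_mult u + \sum_(T in P) \sum_(v in T) mult u v.
  move=> uU; have /setDP[uB _] := uU.
  have -> : \sum_(T in P) \sum_(v in T) mult u v = low_mult u.
    rewrite /low_mult splitB [X in _ = _ + X]big1 ?addn0 // => v vU.
    by rewrite mult_eq0 // (uncovered_independent adj_irr mP).
  by have := deg2d uB; move: (2 * c) cE => k; case: (hub_mult u) => [|h]; lia.
have /(_ (index_enum _)) sumP := leq_sum _ perT.
rewrite 2!big_split -!big_distrr /= in sumP.
have /(_ (index_enum _)) sumU := leq_sum _ perU.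
rewrite big_split -big_distrr [X in _ <= _ + X]exchange_big /= in sumU.
rewrite (splitB (fun b => 0 < hub_mult b : nat)).
rewrite (splitB (fun b => 2 * hub_mult b + low_mult b)) mulnDr.
have combine e X kP SP kU SU : e + X <= kP + SP -> kU <= SU + X ->
  e + kU <= kP + (SP + SU) by clear; lia.
exact: combine sumP sumU.
Qed.

End Charging.

Import Order.TTheory GRing.Theory Num.Theory.
Local Open Scope ring_scope.

(** * Random signs *)

Section Signs.
Variables (R : realFieldType) (I : finType).
Implicit Types e : {ffun I -> bool}.

(** Distinct random signs are uncorrelated: flipping sign [i] negates the sum. *)
Lemma sum_sign_pair (i j : I) :
  \sum_(e : {ffun I -> bool}) (-1) ^+ e i * (-1) ^+ e j
    = (i == j)%:R * #|{ffun I -> bool}|%:R :> R.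
Proof.
have [<-|ij] := eqVneq i j.
  rewrite mul1r -sum1_card natr_sum; apply: eq_bigr => e _.
  by rewrite -expr2 sqrr_sign.
rewrite mul0r.
pose flip (e : {ffun I -> bool}) := [ffun k => (k == i) (+) e k].
have flipK : involutive flip by move=> e; apply/ffunP=> k; rewrite !ffunE addKb.
set S := LHS; suff: S = - S by lra.
rewrite {1}/S (reindex_inj (inv_inj flipK)) -sumrN /=; apply: eq_bigr => e _.
by rewrite !ffunE eqxx eq_sym (negPf ij) signr_addb mulN1r mulNr.
Qed.

Lemma exists_ge_mean (F : {ffun I -> bool} -> R) (mu : R) :
  \sum_(e : {ffun I -> bool}) F e = mu * #|{ffun I -> bool}|%:R -> exists e, mu <= F e.
Proof.
move=> sumF; have [/existsP[e He]|] := boolP [exists e, mu <= F e]; first by exists e.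
rewrite negb_exists => /forallP small.
suff: \sum_(e : {ffun I -> bool}) F e < \sum_(e : {ffun I -> bool}) mu.
  by rewrite sumF sumr_const mulr_natr ltxx.
apply: ltr_sum; last by move=> e _; rewrite ltNge.
by apply/hasP; exists [ffun=> true]; rewrite ?mem_index_enum.
Qed.

(** When every block is flipped by its own random sign, the mean of a quadratic form
in the signs keeps exactly the terms whose two vertices share a block. *)
Lemma blockwise_quadratic (V : finType) (f : V -> I) (tau : V -> bool)
    (c : V -> V -> R) :
  exists chi : V -> bool,
    \sum_x \sum_(y | f x == f y) c x y * ((-1) ^+ tau x * (-1) ^+ tau y)
      <= \sum_x \sum_y c x y * ((-1) ^+ chi x * (-1) ^+ chi y).
Proof.
pose chi (e : {ffun I -> bool}) x := tau x (+) e (f x).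
have [|e He] := @exists_ge_mean (fun e =>
    \sum_x \sum_y c x y * ((-1) ^+ chi e x * (-1) ^+ chi e y))
  (\sum_x \sum_(y | f x == f y) c x y * ((-1) ^+ tau x * (-1) ^+ tau y));
  last by exists (chi e).
rewrite exchange_big mulr_suml; apply: eq_bigr => x _.
rewrite exchange_big mulr_suml [RHS]big_mkcond; apply: eq_bigr => y _ /=.
transitivity (c x y * ((-1) ^+ tau x * (-1) ^+ tau y)
   * \sum_(e : {ffun I -> bool}) (-1) ^+ e (f x) * (-1) ^+ e (f y)).
  by rewrite mulr_sumr; apply: eq_bigr => e _; rewrite !signr_addb; ring.
by rewrite sum_sign_pair; case: eqP => _; rewrite ?mul1r // mul0r mulr0.
Qed.

(** Greedy choice: each new term gets the sign opposite to the partial sum. *)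
Lemma balanced_signs (V : eqType) (l : seq V) (s : V -> R) (t : R) :
  uniq l -> 0 <= t -> {in l, forall a, `|s a| <= t} ->
  exists sigma : V -> bool, `|\sum_(a <- l) (-1) ^+ sigma a * s a| <= t.
Proof.
move=> + t0; elim: l => [|a l IH] /=.
  by exists xpredT; rewrite big_nil normr0.
case/andP=> al ul st.
have [|sigma Hs] := IH ul.
  by move=> b bl; apply: st; rewrite inE bl orbT.
set S := \sum_(b <- l) _ in Hs.
exists (fun b => if b == a then (0 <= S) (+) (s a < 0) else sigma b).
rewrite big_cons eqxx (eq_big_seq (fun b => (-1) ^+ sigma b * s b)); last first.
  by move=> b bl; case: eqP => // E; rewrite -E bl in al.
rewrite -/S; have := st a (mem_head _ _); move: Hs.
by case: (lerP 0 S) => S0; case: (ltrP (s a) 0) => s0 /=;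
  rewrite ?expr0 ?expr1 ?mul1r ?mulN1r !ler_norml => /andP[? ?] /andP[? ?];
  apply/andP; split; lra.
Qed.

End Signs.

(** * Bipartitions from signs of blocks *)

Section Signing.
Variables (R : realFieldType) (V : finType) (D : rel V).

Definition net (v : V) : R := (outdeg D v)%:R - (indeg D v)%:R.

Lemma arcs_between_sum (S T : {set V}) :
  (arcs_between D S T)%:R
    = \sum_x \sum_y (D x y)%:R * ((x \in S)%:R * (y \in T)%:R) :> R.
Proof.
rewrite pair_big /arcs_between -sum1_card natr_sum big_mkcond /=.
apply: eq_bigr => -[x y] _ /=; rewrite !inE /=.
by case: (D x y); case: (x \in S); case: (y \in T); rewrite ?mul1r ?mul0r ?mulr0.
Qed.

Lemma sum_net (z : V -> R) :
  \sum_v z v * net v = \sum_x \sum_y (D x y)%:R * (z x - z y).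
Proof.
have -> : \sum_x \sum_y (D x y)%:R * (z x - z y)
    = \sum_x \sum_y (D x y)%:R * z x - \sum_x \sum_y (D x y)%:R * z y.
  rewrite -sumrB; apply: eq_bigr => x _; rewrite -sumrB.
  by apply: eq_bigr => y _; rewrite mulrBr.
rewrite [X in _ - X]exchange_big /= -sumrB; apply: eq_bigr => v _.
by rewrite /net outdeg_sum indeg_sum !natr_sum mulrC mulrBl !mulr_suml.
Qed.

Variables (I : finType) (f : V -> I) (tau : V -> bool) (lam : R).
Hypothesis lam_gt0 : 0 < lam.
Hypothesis variance : \sum_x \sum_(y | f x == f y)
  net x * net y * ((-1) ^+ tau x * (-1) ^+ tau y) <= lam ^+ 2.

(** Let [X] be the sum of products of signs over the arcs and [Y] the signed sum of
the net degrees.  The two arc counts add up to [(m - X) / 2] and differ by [Y / 2],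
and [|Y| <= Y ^+ 2 / (2 * lam) + lam / 2]; so twice the minimum is bounded below by
a quadratic form in the signs, and the mean over block flips gives a good signing.
The hypothesis [variance] says that [Y] has second moment at most [lam ^+ 2]. *)
Lemma blockwise_bipartition : exists V1 : {set V},
  (#|arcs D|)%:R / 2 - lam / 2 - (\sum_x \sum_(y | f x == f y)
     (D x y)%:R * ((-1) ^+ tau x * (-1) ^+ tau y)) / 2
  <= 2 * (minn (arcs_between D V1 (~: V1)) (arcs_between D (~: V1) V1))%:R :> R.
Proof.
pose c x y : R := - (D x y)%:R / 2 - net x * net y / (4 * lam).
have [chi Hchi] := blockwise_quadratic f tau c.
pose z x : R := (-1) ^+ chi x.
set St := (\sum_x \sum_(y | f x == f y) (D x y)%:R * _).
have varW := variance; set W := (\sum_x _) in varW.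
pose Y := \sum_v z v * net v.
pose X := \sum_x \sum_y (D x y)%:R * (z x * z y).
have lam0 : lam != 0 by rewrite gt_eqF.
have lhs : \sum_x \sum_(y | f x == f y) c x y * ((-1) ^+ tau x * (-1) ^+ tau y)
    = - St / 2 - W / (4 * lam).
  rewrite /St /W -sumrN !mulr_suml -sumrB; apply: eq_bigr => x _.
  rewrite -sumrN !mulr_suml -sumrB; apply: eq_bigr => y _.
  by rewrite /c; field.
have rhs : \sum_x \sum_y c x y * ((-1) ^+ chi x * (-1) ^+ chi y)
    = - X / 2 - Y ^+ 2 / (4 * lam).
  rewrite /X /Y expr2 big_distrlr /= -sumrN !mulr_suml -sumrB.
  apply: eq_bigr => x _.
  rewrite -sumrN !mulr_suml -sumrB; apply: eq_bigr => y _.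
  by rewrite /c /z; field.
rewrite lhs rhs in Hchi.
exists [set v | ~~ chi v]; set V1 := [set v | _].
have in1 v : (v \in V1)%:R = (1 + z v) / 2 :> R.
  by rewrite inE /z; case: (chi v); rewrite /= ?expr0 ?expr1; field.
have in2 v : (v \in ~: V1)%:R = (1 - z v) / 2 :> R.
  by rewrite !inE /z negbK; case: (chi v); rewrite /= ?expr0 ?expr1; field.
set e12 := arcs_between _ _ _; set e21 := arcs_between _ (~: _) _.
have mE : #|arcs D|%:R = \sum_x \sum_y (D x y)%:R :> R.
  by rewrite card_arcs natr_sum; apply: eq_bigr => x _; rewrite natr_sum.
have sumE : e12%:R + e21%:R = #|arcs D|%:R / 2 - X / 2 :> R.
  rewrite !arcs_between_sum mE /X -big_split !mulr_suml -sumrB; apply: eq_bigr => x _.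
  rewrite -big_split !mulr_suml -sumrB; apply: eq_bigr => y _ /=.
  by rewrite !in1 !in2; field.
have diffE : e12%:R - e21%:R = Y / 2 :> R.
  rewrite !arcs_between_sum /Y sum_net -sumrB !mulr_suml; apply: eq_bigr => x _.
  rewrite -sumrB !mulr_suml; apply: eq_bigr => y _ /=.
  by rewrite !in1 !in2; field.
have Wl : W / (4 * lam) <= lam / 4.
  rewrite ler_pdivrMr ?mulr_gt0 // (le_trans varW) // le_eqVlt; apply/orP; left.
  by apply/eqP; field.
have [amgm1 amgm2] : Y / 2 <= Y ^+ 2 / (4 * lam) + lam / 4 /\
    - (Y / 2) <= Y ^+ 2 / (4 * lam) + lam / 4.
  have sq (y : R) : y / 2 <= y ^+ 2 / (4 * lam) + lam / 4.
    rewrite -subr_ge0.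
    have -> : y ^+ 2 / (4 * lam) + lam / 4 - y / 2 = (y - lam) ^+ 2 / (4 * lam) by field.
    by rewrite divr_ge0 ?sqr_ge0 // mulr_ge0 // ltW.
  by split; [exact: sq | rewrite -mulNr -(sqrrN Y); exact: sq].
by case: (leqP e12 e21) => _; lra.
Qed.

End Signing.

Section Blocks.
Variables (V : finType) (D : rel V) (A : {set V}) (P : {set {set V}}).
Hypothesis Dirr : irreflexive D.
Let B := ~: A.
Hypothesis pP : packing (adj D) B P.

(** All hubs share one block, so that their signs relative to each other can be
prescribed. *)
Definition block (v : V) : {set V} :=
  if v \in A then A else if v \in cover P then pblock P v else [set v].

(** In an edge both ends are centres of the star, hence the choice by [pick]. *)
Definition relative_sign (sigma : V -> bool) (v : V) : bool :=
  if v \in A then sigma v else [pick x | star (adj D) x (block v)] == Some v.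

Let tP : trivIset P. Proof. by case/andP: pP. Qed.

Lemma mem_block v : v \in block v.
Proof.
rewrite /block; case: ifP => // _; case: ifP => [vP|_]; last by rewrite inE.
by rewrite mem_pblock.
Qed.

Lemma eq_block x y : block x = block y -> y \in block x.
Proof. by move->; apply: mem_block. Qed.

Lemma block_hub a y : a \in A -> (block a == block y) = (y \in A).
Proof.
move=> aA; apply/eqP/idP => [/eq_block|yA]; last by rewrite /block aA yA.
by rewrite {1}/block aA.
Qed.

Lemma block_low b : b \in B -> (#|[pred y | block b == block y]| <= 3)%N.
Proof.
rewrite inE => bA; apply: (@leq_trans #|block b|).
  by apply: subset_leq_card; apply/subsetP=> y /eqP/eq_block.
rewrite /block (negPf bA); case: ifP => [bP|_]; last by rewrite cards1.
by have /and3P[_ /andP[]] := packingP pP (pblock_mem bP).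
Qed.

(** Pieces are induced stars, so each of their arcs joins the centre to a leaf. *)
Lemma relative_sign_arc sigma x y : x \in B -> block x = block y -> D x y ->
  relative_sign sigma x = ~~ relative_sign sigma y.
Proof.
rewrite inE => xA E Dxy.
have yA : y \notin A.
  by apply: contra xA => yA; rewrite -(block_hub x yA) E.
have yT := eq_block E; have xT := mem_block x.
rewrite /relative_sign (negPf xA) (negPf yA) -E.
have xy : x != y by apply: contraTneq Dxy => ->; rewrite Dirr.
move: yT xT; rewrite /block (negPf xA); case: ifP => [xP|_]; last first.
  by rewrite !inE eq_sym (negPf xy).
set T := pblock P x => yT xT.
have /and3P[_ _ /existsP[c0 sc0]] := packingP pP (pblock_mem xP).
case: pickP => [c /and3P[cT _ /forall_inP indep]|/(_ c0)]; last by rewrite sc0.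
have [xc|xc] := eqVneq x c.
  by rewrite -xc eqxx; case: eqP => // -[/eqP]; rewrite (negPf xy).
have [yc|yc] := eqVneq y c.
  by rewrite -yc eqxx; case: eqP => // -[/eqP]; rewrite eq_sym (negPf xy).
have xD : x \in T :\ c by rewrite !inE xc.
have yD : y \in T :\ c by rewrite !inE yc.
by have /forall_inP/(_ y yD) := indep x xD; rewrite /adj Dxy.
Qed.

Lemma arcs_in_blocks :
  (\sum_(T in P) arcs_in D T
    <= \sum_(x in B) \sum_(y | block x == block y) D x y)%N.
Proof.
have PB := cover_subset pP.
rewrite [leqRHS](bigID (mem (cover P))) /=; apply: leq_trans (leq_addr _ _).
rewrite (eq_bigl (mem (cover P))); last first.
  by move=> x; rewrite andbC /=; case: (boolP (x \in cover P)) => // /(subsetP PB)->.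
rewrite big_trivIset //=; apply: leq_sum => T PT; apply: leq_sum => x xT.
rewrite (eq_bigl (fun y => block x == block y)) // => y.
have inP t : t \in T -> block t = T.
  move=> tT; have tP' : t \in cover P by apply/bigcupP; exists T.
  have := subsetP PB t tP'; rewrite inE /block => /negPf->.
  by rewrite tP'; apply: def_pblock.
rewrite (inP x xT); apply/idP/eqP => [/inP->//|E].
by rewrite E mem_block.
Qed.

(** All neighbours of a hub are hubs or have a hub neighbour, and the net degree is
at most the larger of the outdegree and the indegree. *)
Lemma net_hub (R : realFieldType) a : a \in A ->
  `|net R D a| <= (\sum_(b in B) (0 < hub_mult D A b) + #|A|)%N%:R.
Proof.
move=> aA; set t := (_ + _)%N.
have bound (E : V -> bool) : (forall y, E y -> adj D y a) -> (\sum_y E y <= t)%N.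
  move=> Ea; rewrite (bigID (mem A)) /= addnC; apply: leq_add.
    rewrite (eq_bigl (mem B)); last by move=> y; rewrite !inE.
    apply: leq_sum => y _; case Ey: (E y) => //.
    by rewrite /hub_mult (bigD1 a) //= addn_gt0 mult_gt0 Ea.
  by rewrite -sum1_card leq_sum // => y _; case: (E y).
have o : (outdeg D a)%:R <= t%:R :> R.
  by rewrite ler_nat outdeg_sum bound // => y; rewrite /adj orbC => ->.
have i : (indeg D a)%:R <= t%:R :> R.
  by rewrite ler_nat indeg_sum bound // => y; rewrite /adj => ->.
have := ler0n R (outdeg D a); have := ler0n R (indeg D a).
by move: o i; rewrite /net ler_norml => *; apply/andP; split; lra.
Qed.

End Blocks.

(** * Hubs *)

Section HubBound.
Variables (R : realFieldType) (V : finType) (D : rel V) (d : nat).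
Hypotheses (Dirr : irreflexive D) (d_gt0 : (0 < d)%N).
Hypothesis deg2d : forall v, (2 * d <= outdeg D v + indeg D v)%N.
Variable delta : R.
Hypothesis delta_gt0 : 0 < delta.

Let m := #|arcs D|.
Let A := [set v | delta < (outdeg D v + indeg D v)%:R].
Let B := ~: A.
Let s := @net R V D.

Lemma few_hubs : #|A|%:R * delta <= 2 * m%:R.
Proof.
rewrite -natrM -handshake natr_sum -sum1_card natr_sum mulr_suml.
rewrite [leRHS](bigID (mem A)) /= -[leLHS]addr0 lerD ?sumr_ge0 //.
by apply: ler_sum => v; rewrite inE mul1r => /ltW.
Qed.

Lemma net_le v : `|s v| <= (outdeg D v + indeg D v)%:R.
Proof.
have := ler0n R (outdeg D v); have := ler0n R (indeg D v).
by rewrite /s /net natrD ler_norml => *; apply/andP; split; lra.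
Qed.

(** The hubs get signs making their net degrees add up to at most [t]; the other
blocks have at most three vertices of degree at most [delta], so they add at most
[3 * delta * 2 * m <= mu ^+ 2] to the second moment, and [t%:R + mu] can serve as
[lam].  The loss [t] of the hubs is paid by the [q] arcs inside pieces, all of which
are cut, up to [m / (2 * d - 1)] by [charging]. *)
Lemma bipartition_few_hubs (mu : R) : 0 < mu -> 6 * m%:R * delta <= mu ^+ 2 ->
  exists V1 : {set V},
   m%:R / 2 - m%:R / (2 * (2 * d%:R - 1)) - mu / 2 - (#|A|%:R ^+ 2 + #|A|%:R) / 2
     <= 2 * (minn (arcs_between D V1 (~: V1)) (arcs_between D (~: V1) V1))%:R :> R.
Proof.
move=> mu0 mudelta.
have [P mP] := exists_max_packing (adj D) B.
have [pP _] := mP.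
pose n0 := (\sum_(b in B) (0 < hub_mult D A b))%N.
pose t := (n0 + #|A|)%N.
pose q := (\sum_(T in P) arcs_in D T)%N.
have [a|sigma hsigma] := @balanced_signs R V (enum A) s t%:R (enum_uniq _) (ler0n _ _).
  by rewrite mem_enum => aA; apply: net_hub.
rewrite big_enum /= in hsigma.
pose f := block A P; pose tau := relative_sign D A P sigma.
have hubs a y : a \in A -> (f a == f y) = (y \in A) by move=> aA; exact: block_hub.
have variance : \sum_x \sum_(y | f x == f y)
  s x * s y * ((-1) ^+ tau x * (-1) ^+ tau y) <= (t%:R + mu) ^+ 2 :> R.
  rewrite (bigID (mem A)) /=.
  (* all hubs lie in one block, so their part of the sum is a square *)
  have -> : \sum_(x in A) \sum_(y | f x == f y) s x * s y * ((-1) ^+ tau x * (-1) ^+ tau y)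
      = (\sum_(a in A) (-1) ^+ sigma a * s a) ^+ 2.
    rewrite expr2 big_distrlr /=; apply: eq_bigr => x xA.
    rewrite (eq_bigl _ _ (fun y => hubs x y xA)); apply: eq_bigr => y yA.
    by rewrite /tau /relative_sign xA yA; ring.
  have -> : (t%:R + mu) ^+ 2 = t%:R ^+ 2 + (mu ^+ 2 + 2 * t%:R * mu) by ring.
  apply: lerD.
    by rewrite -[leLHS]real_normK ?num_real // lerXn2r ?nnegrE.
  apply: (@le_trans _ _ (mu ^+ 2)); last by rewrite lerDl !mulr_ge0 // ltW.
  apply: le_trans mudelta.
  apply: (@le_trans _ _ (\sum_x (outdeg D x + indeg D x)%:R * (3 * delta))); last first.
    by rewrite -mulr_suml -natr_sum handshake natrM -/m; lra.
  rewrite [leRHS](bigID (mem A)) /= -[leLHS]add0r lerD //.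
    by apply: sumr_ge0 => x _; rewrite !mulr_ge0 // ltW.
  apply: ler_sum => x xA.
  have xB : x \in B by rewrite inE.
  have low y : y \in B -> `|s y| <= delta.
    by rewrite !inE -leNgt; apply: le_trans (net_le y).
  apply: (@le_trans _ _ (\sum_(y | f x == f y) `|s x| * delta)).
    apply: ler_sum => y /eqP fxy; apply: le_trans (ler_norm _) _.
    rewrite !normrM !normr_sign !mulr1 ler_wpM2l // low // inE.
    by apply: contra xA => yA; rewrite -(hubs y x yA) fxy.
  rewrite sumr_const -[leLHS]mulr_natr -mulrA.
  apply: ler_pM => //; first by rewrite mulr_ge0 // ltW.
    exact: net_le.
  rewrite mulrC ler_wpM2r ?(ltW delta_gt0) // (ler_nat _ _ 3).
  exact: (block_low pP xB).
have lam0 : 0 < t%:R + mu by rewrite ltr_wpDl.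
have [V1 HV1] := blockwise_bipartition lam0 variance.
exists V1; apply: le_trans HV1; rewrite -/m.
have signed : \sum_x \sum_(y | f x == f y) (D x y)%:R * ((-1) ^+ tau x * (-1) ^+ tau y)
    <= #|A|%:R ^+ 2 - q%:R :> R.
  rewrite (bigID (mem A)) /=; apply: lerD.
    rewrite expr2 -natrM -sum_nat_const natr_sum; apply: ler_sum => x xA.
    rewrite (eq_bigl _ _ (fun y => hubs x y xA)) -sum1_card natr_sum.
    apply: ler_sum => y _; apply: le_trans (ler_norm _) _.
    by rewrite !normrM !normr_sign !mulr1 normr_nat lern1 leq_b1.
  have : (q <= \sum_(x in B) \sum_(y | f x == f y) D x y)%N := arcs_in_blocks pP.
  rewrite -(ler_nat R) -lerN2; apply: le_trans; rewrite natr_sum -sumrN.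
  rewrite (eq_bigl (mem B)) => [|x]; last by rewrite !inE.
  apply: ler_sum => x xB; rewrite natr_sum -sumrN; apply: ler_sum => y /eqP fxy.
  case Dxy: (D x y); rewrite ?mul0r ?oppr0 //.
  have -> : tau x = ~~ tau y by exact: (relative_sign_arc Dirr pP sigma xB fxy Dxy).
  by rewrite signrN mulNr -expr2 sqrr_sign mul1r.
have charge : (2 * d%:R - 1) * n0%:R <= (2 * d%:R - 1) * q%:R + m%:R :> R.
  have degB b : b \in B -> (2 * d <= hub_mult D A b + low_mult D A b)%N.
    by move=> _; rewrite -degree_split.
  have := charging Dirr d_gt0 degB mP; rewrite -/n0 -/q -/m -!mulnA -mulnDr leq_pmul2l //.
  rewrite -(ler_nat R) natrD !natrM natrB ?natrM //; lia.
have d1 : 1 <= d%:R :> R by rewrite ler1n.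
have n0q : n0%:R - q%:R <= m%:R / (2 * d%:R - 1) :> R.
  by rewrite ler_pdivlMr; [rewrite mulrC; lra | lra].
have -> : m%:R / (2 * (2 * d%:R - 1)) = m%:R / (2 * d%:R - 1) / 2 :> R by field; lra.
by move: n0q signed; rewrite /t natrD; lra.
Qed.

End HubBound.

Theorem theorem1p2 (R : realType) (d : nat) (hd : (2 <= d)%N)
    (eps : R) (heps : 0 < eps) :
  exists m0 : nat,
    forall (V : finType) (D : rel V),
      irreflexive D ->
      (forall x : V, (d <= outdeg D x)%N) ->
      (forall x : V, (d <= indeg D x)%N) ->
      (m0 <= #|arcs D|)%N ->
      exists V1 V2 : {set V},
        bipartition V1 V2 /\
        ((d%:R - 1) / (2 * (2 * d%:R - 1)) - eps) * #|arcs D|%:R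
          <= (minn (arcs_between D V1 V2) (arcs_between D V2 V1))%:R :> R.
Proof.
(* [K] bounds the number of hubs when [delta = eps ^+ 2 / 6 * m] *)
pose K : R := 12 / eps ^+ 2.
have eps2 : 0 < eps ^+ 2 by rewrite exprn_gt0.
have K0 : 0 <= K by rewrite divr_ge0 // ltW.
exists (Num.bound ((K ^+ 2 + K) / eps)).+1 => V D Dirr outd ind m0m.
set m := #|arcs D| in m0m *.
have m_gt0 : 0 < m%:R :> R by rewrite ltr0n (leq_ltn_trans _ m0m).
have Km : K ^+ 2 + K <= eps * m%:R.
  rewrite mulrC -ler_pdivrMr //; apply: ltW.
  apply: lt_trans (archi_boundP _) _; last by rewrite ltr_nat.
  by rewrite divr_ge0 ?addr_ge0 ?exprn_ge0 // ltW.
have deg2d v : (2 * d <= outdeg D v + indeg D v)%N.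
  by rewrite mul2n -addnn leq_add.
pose delta : R := eps ^+ 2 / 6 * m%:R.
have delta_gt0 : 0 < delta by rewrite /delta !mulr_gt0 // invr_gt0.
have mu_gt0 : 0 < eps * m%:R by rewrite mulr_gt0.
have mudelta : 6 * m%:R * delta <= (eps * m%:R) ^+ 2.
  by rewrite le_eqVlt; apply/orP; left; apply/eqP; rewrite /delta; field.
have [V1 HV1] := bipartition_few_hubs Dirr (ltnW hd) deg2d delta_gt0 mu_gt0 mudelta.
exists V1, (~: V1); split.
  by split; [rewrite setUCr | rewrite disjoints_subset setCK].
have hubK := few_hubs D delta; move: HV1 hubK; rewrite -/m.
set a : R := #|[set v | delta < _]|%:R => HV1 hubK.
have aK : a <= K.
  rewrite /K ler_pdivlMr // -(ler_pM2r m_gt0).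
  have -> : a * eps ^+ 2 * m%:R = 6 * (a * delta) by rewrite /delta; field.
  by lra.
have aaKK : a ^+ 2 + a <= K ^+ 2 + K by rewrite lerD // lerXn2r ?nnegrE ?ler0n.
have d2 : 2 <= d%:R :> R by rewrite (ler_nat _ 2).
have ratio : (d%:R - 1) / (2 * (2 * d%:R - 1)) * m%:R
    = m%:R / 4 - m%:R / (2 * (2 * d%:R - 1)) / 2 :> R by field; lra.
by rewrite mulrBl ratio; move: HV1; lra.
Qed.
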